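(* Let $q=mf+1$ be a power of a prime, with $m,f$ positive integers. Suppose $f+1=\lambda m$ with $\lambda$ an integer, and let $\chi$ be a multiplicative character of order $m$ on $\mathbb{F}_q$. Then $M_{q,m}$ is a $(q,f+1,\lambda)$-difference set in $\mathbb{F}_q$ if and only if $$\sum_{t=1}^{m-1}J_q(\chi^s,\chi^t)=1-m-m\chi^s(-1),\quad s=1,\dots,m-1.$$
   Context: $H_{q,m}$ denotes the set of nonzero $m$th powers in $\mathbb{F}_q$ and $M_{q,m}=H_{q,m}\cup\{0\}$. A subset $D\subseteq\mathbb{F}_q$ of size $k$ is a $(q,k,\lambda)$-difference set in $\mathbb{F}_q$ if for each nonzero $a\in\mathbb{F}_q$ there are exactly $\lambda$ ordered pairs $(x,y)\in D\times D$ with $x-y=a$. A multiplicative character on $\mathbb{F}_q$ is a homomorphism $\mathbb{F}_q^*\to\mathbb{C}^*$ extended to $0$ by the value $1$ if the character is trivial and $0$ if it is nontrivial. For $s\in\mathbb{Z}$, $\chi^s$ is the $s$th power of $\chi$ as a character of $\mathbb{F}_q^*$, extended to $0$ by this same rule. The Jacobi sum of multiplicative characters $\chi,\psi$ on $\mathbb{F}_q$ is $J_q(\chi,\psi)=\sum_{\alpha\in\mathbb{F}_q}\chi(\alpha)\psi(1-\alpha)$. *)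

(* Defs.v *)
From HB Require Import structures.
From mathcomp Require Import all_boot all_order all_algebra all_fingroup.

Set Implicit Arguments.
Unset Strict Implicit.
Unset Printing Implicit Defensive.

Import Order.TTheory GRing.Theory Num.Theory.
Local Open Scope ring_scope.

Section PowersAndDifferenceSets.
Variable F : finFieldType.

Definition nonzero_powers (m : nat) : {set F} :=
  [set x ^+ m | x : F] :\ 0.

Definition powers_with_zero (m : nat) : {set F} := 0 |: nonzero_powers m.

Definition is_difference_set (q k lambda : nat) (D : {set F}) : Prop :=
  [/\ #|F| = q, #|D| = k &
      forall a : F, a != 0 ->
        #|[set xy in setX D D | xy.1 - xy.2 == a]| = lambda].

End PowersAndDifferenceSets.

Section MultiplicativeCharacters.
Variables (F : finFieldType) (C : fieldType).

Record mulchar := MulChar {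
  mulchar_unit : {unit F} -> C;
  mulchar_unit_neq0 : forall u, mulchar_unit u != 0;
  mulchar_unitM : forall u v,
    mulchar_unit (u * v)%g = mulchar_unit u * mulchar_unit v }.

Definition mulchar_trivial (chi : mulchar) : bool :=
  [forall u, mulchar_unit chi u == 1].

(* Extension to F; [insub x] is [None] exactly when [x] is not a unit,
   that is, when [x = 0]. *)
Definition mulchar_eval (chi : mulchar) (x : F) : C :=
  if insub x is Some u then mulchar_unit chi u
  else (mulchar_trivial chi)%:R.

Fact mulchar_exp_neq0 (chi : mulchar) (s : int) (u : {unit F}) :
  mulchar_unit chi u ^ s != 0.
Proof. by rewrite expfz_neq0 ?mulchar_unit_neq0. Qed.

Fact mulchar_expM (chi : mulchar) (s : int) (u v : {unit F}) :
  mulchar_unit chi (u * v)%g ^ s =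
    mulchar_unit chi u ^ s * mulchar_unit chi v ^ s.
Proof. by rewrite mulchar_unitM expfzMl. Qed.

(* The power is taken on units only, so the value at 0 of the power is given by
   the extension rule above, not by powering the value of [chi] at 0. *)
Definition mulchar_exp (chi : mulchar) (s : int) : mulchar :=
  MulChar (mulchar_exp_neq0 chi s) (mulchar_expM chi s).

Definition mulchar_has_order (chi : mulchar) (n : nat) : Prop :=
  [/\ (0 < n)%N, mulchar_trivial (mulchar_exp chi n%:Z) &
      forall k : nat, (0 < k < n)%N ->
        ~~ mulchar_trivial (mulchar_exp chi k%:Z)].

Definition jacobi_sum (chi psi : mulchar) : C :=
  \sum_(a : F) mulchar_eval chi a * mulchar_eval psi (1 - a).

End MultiplicativeCharacters.

(* Main.v *)
Require Import Defs.
From mathcomp Require Import all_boot all_order all_algebra all_fingroup.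
From mathcomp Require Import cyclic ring.
From mathcomp Require Import reals complex.

Set Implicit Arguments.
Unset Strict Implicit.
Unset Printing Implicit Defensive.

Import GRing.Theory.
Local Open Scope ring_scope.
Local Open Scope complex_scope.

(** Write [H] for the nonzero [m]th powers, [M] for [H] with [0] added, and
[N a] for the number of representations of [a] as a difference of two elements
of [M].  Since [M] is stable under multiplication by [H], [N] is constant on
the cosets of [H] in the multiplicative group, so away from [0] it is a function
on a cyclic group of order [m] whose characters are the [chi ^ s], [0 <= s < m].
Such a function is constant exactly when its Fourier coefficients
[\sum_a chi ^ s a * N a] vanish for [1 <= s < m].  The constant is then
[lambda], because there are [(f + 1) f = lambda m f] pairs of distinct elements
of [M] ([sum_neq0_diff_count]); so [N - lambda] has all its Fourier coefficients
zero, and [fourier_vanishing] applies to it.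

Each coefficient is [\sum_(x in M) \sum_(y in M) chi ^ s (x - y)].  The terms
with [x = 0] or [y = 0] contribute [f (1 + chi ^ s (-1))]; in the others one
factors out [x], on which [chi ^ s] is [1], and obtains
[f \sum_(z in H) chi ^ s (1 - z)] ([char_sum_differences]).  Finally
[\sum_t chi ^ t] is [m] times the indicator function of [H], up to a correction
at [0] ([sum_char_powers]); substituting this for the condition [z in H] turns
the last sum into Jacobi sums ([sum_jacobi]).  The coefficient is thus [f / m]
times the difference of the two sides of the Jacobi sum identity. *)

(** * Multiplicative characters *)

Section Characters.
Variables (F : finFieldType) (C : fieldType).
Implicit Types (chi psi : mulchar F C) (x y : F).

Lemma mulchar_eval_unit chi (u : {unit F}) :
  mulchar_eval chi (val u) = mulchar_unit chi u.
Proof. by rewrite /mulchar_eval valK. Qed.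

Lemma neq0_unit x : x != 0 -> exists u : {unit F}, x = val u.
Proof.
move=> x0; have ux : x \is a GRing.unit by rewrite unitfE.
by exists (FinRing.unit F ux).
Qed.

Lemma mulchar_eval0 chi : mulchar_eval chi 0 = (mulchar_trivial chi)%:R.
Proof. by rewrite /mulchar_eval insubN // unitr0. Qed.

Lemma mulchar_eval_neq0 chi x : x != 0 -> mulchar_eval chi x != 0.
Proof.
by move=> /neq0_unit[u ->]; rewrite mulchar_eval_unit mulchar_unit_neq0.
Qed.

Lemma mulchar_evalM chi x y : x != 0 -> y != 0 ->
  mulchar_eval chi (x * y) = mulchar_eval chi x * mulchar_eval chi y.
Proof.
move=> /neq0_unit[u ->] /neq0_unit[v ->].
by rewrite -[val u * val v]/(val (u * v)%g) !mulchar_eval_unit mulchar_unitM.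
Qed.

Lemma mulchar_evalMl chi x y : ~~ mulchar_trivial chi -> x != 0 ->
  mulchar_eval chi (x * y) = mulchar_eval chi x * mulchar_eval chi y.
Proof.
move=> /negbTE ntr x0; have [->|y0] := eqVneq y 0; last exact: mulchar_evalM.
by rewrite mulr0 mulchar_eval0 ntr mulr0.
Qed.

Lemma mulchar_eval1 chi : mulchar_eval chi 1 = 1.
Proof.
have n0 := mulchar_eval_neq0 chi (@oner_neq0 F).
by apply: (mulfI n0); rewrite -mulchar_evalM ?oner_neq0 // !mulr1.
Qed.

Lemma mulchar_evalX chi x n : x != 0 ->
  mulchar_eval chi (x ^+ n) = mulchar_eval chi x ^+ n.
Proof.
move=> x0; elim: n => [|n IHn]; first by rewrite !expr0 mulchar_eval1.
by rewrite !exprS mulchar_evalM ?expf_neq0 // IHn.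
Qed.

Lemma mulchar_eval_exp chi (n : nat) x : x != 0 ->
  mulchar_eval (mulchar_exp chi n%:Z) x = mulchar_eval chi x ^+ n.
Proof. by move=> /neq0_unit[u ->]; rewrite !mulchar_eval_unit. Qed.

Lemma mulchar_trivialP chi :
  reflect (forall x, x != 0 -> mulchar_eval chi x = 1) (mulchar_trivial chi).
Proof.
apply: (iffP forallP) => [tr x /neq0_unit[u ->]|tr u].
  by rewrite mulchar_eval_unit; apply/eqP.
by rewrite -mulchar_eval_unit tr // -unitfE; apply: valP.
Qed.

Lemma mulchar_exp0_trivial chi : mulchar_trivial (mulchar_exp chi 0%N%:Z).
Proof. by apply/mulchar_trivialP => x x0; rewrite mulchar_eval_exp. Qed.

(** Multiplication by a unit at which [chi] is not [1] permutes the field and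
multiplies the sum by a constant different from [1]. *)
Lemma sum_mulchar_nontrivial chi : ~~ mulchar_trivial chi ->
  \sum_x mulchar_eval chi x = 0.
Proof.
move=> ntr; move: (ntr); rewrite negb_forall => /existsP[u].
rewrite -mulchar_eval_unit => chiu1.
have u0 : val u != 0 by rewrite -unitfE; apply: valP.
set S := \sum_x _.
have SE : S = mulchar_eval chi (val u) * S.
  rewrite {1}/S (reindex_inj (mulfI u0)) mulr_sumr.
  by apply: eq_bigr => x _; rewrite mulchar_evalMl.
apply/eqP; move: chiu1; apply: contraNT => S0.
by apply/eqP/(mulIf S0); rewrite -SE mul1r.
Qed.

Lemma sum_neq0_mulchar_nontrivial chi : ~~ mulchar_trivial chi ->
  \sum_(x | x != 0) mulchar_eval chi x = 0.
Proof.
move=> ntr; apply: etrans (sum_mulchar_nontrivial ntr).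
by rewrite [RHS](bigD1 0) //= mulchar_eval0 (negbTE ntr) add0r.
Qed.

End Characters.

(** * Powers and their detection by a character *)

Section Powers.
Variables (F : finFieldType) (m : nat).
Local Notation H := (nonzero_powers F m).
Local Notation M := (powers_with_zero F m).

Lemma nonzero_power_neq0 (x : F) : x \in H -> x != 0.
Proof. by rewrite !inE => /andP[]. Qed.

Lemma mem_nonzero_power (x : F) : x != 0 -> x ^+ m \in H.
Proof. by move=> x0; rewrite !inE expf_neq0 //=; apply/imsetP; exists x. Qed.

Lemma nonzero_powerP (x : F) :
  reflect (exists2 y, y != 0 & x = y ^+ m) (x \in H).
Proof.
apply: (iffP idP) => [|[y y0 ->]]; last exact: mem_nonzero_power.
rewrite !inE => /andP[x0 /imsetP[y _ xE]].
have [y0|] := eqVneq y 0; last by exists y.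
(* If [y = 0] then [m = 0] because [x] is nonzero, and [x = 1]. *)
move: x0; rewrite xE y0 expr0n; case: (m) => [|k]; last by rewrite eqxx.
by exists 1; rewrite ?oner_neq0.
Qed.

Lemma mul_nonzero_power (h x : F) : h \in H -> (h * x \in H) = (x \in H).
Proof.
move=> /nonzero_powerP[y y0 ->]; apply/nonzero_powerP/nonzero_powerP.
  move=> [z z0 yx]; exists (z / y); first by rewrite mulf_neq0 ?invr_neq0.
  by rewrite expr_div_n -yx mulrC mulKf ?expf_neq0.
by move=> [z z0 ->]; exists (y * z); rewrite ?mulf_neq0 ?exprMn.
Qed.

Lemma mul_powers_with_zero (h x : F) : h \in H -> (h * x \in M) = (x \in M).
Proof.
move=> Hh; rewrite !(in_setU1, mulf_eq0) (mul_nonzero_power _ Hh).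
by rewrite (negbTE (nonzero_power_neq0 Hh)).
Qed.

Lemma card_nonzero_powers_gt0 : (0 < #|H|)%N.
Proof.
apply/card_gt0P; exists (1 ^+ m).
by apply: mem_nonzero_power; apply: oner_neq0.
Qed.

Lemma card_powers_with_zero : #|M| = #|H|.+1.
Proof. by rewrite cardsU1 !inE eqxx. Qed.

Lemma sum_powers_with_zero (V : nmodType) (phi : F -> V) :
  \sum_(x in M) phi x = phi 0 + \sum_(x in H) phi x.
Proof. by rewrite big_setU1 //= !inE eqxx. Qed.

End Powers.

Section CharacterOfOrder.
Variables (F : finFieldType) (C : numFieldType) (m : nat) (chi : mulchar F C).
Hypothesis chi_order : mulchar_has_order chi m.
Local Notation H := (nonzero_powers F m).
Local Notation "psi @[ x ]" := (mulchar_eval psi x) (at level 2, x at level 200,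
  format "psi @[ x ]").

Lemma mulchar_order_gt0 : (0 < m)%N. Proof. by case: chi_order. Qed.

Lemma mulchar_eval_order (x : F) : x != 0 -> chi@[x] ^+ m = 1.
Proof.
by case: chi_order => _ /mulchar_trivialP tr _ x0; rewrite -mulchar_eval_exp ?tr.
Qed.

Lemma mulchar_exp_nontrivial (s : nat) : (1 <= s < m)%N ->
  ~~ mulchar_trivial (mulchar_exp chi s%:Z).
Proof. by case: chi_order => _ _; apply. Qed.

Lemma mulchar_exp_nonzero_power (s : nat) (h : F) : h \in H ->
  (mulchar_exp chi s%:Z)@[h] = 1.
Proof.
move=> /nonzero_powerP[y y0 ->].
rewrite mulchar_evalX // mulchar_eval_exp // exprAC.
by rewrite mulchar_eval_order // expr1n.
Qed.

(** The unit group is cyclic and [chi] takes a value of exact order [m] at a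
generator, so [chi] is [1] only at those powers of the generator whose exponent
is divisible by [m]. *)
Lemma mulchar_eval_eq1 (x : F) : x != 0 -> (chi@[x] == 1) = (x \in H).
Proof.
move=> x0; apply/eqP/idP => [chix|Hx]; last first.
  by rewrite -[LHS]expr1 -mulchar_eval_exp // mulchar_exp_nonzero_power.
have [g genE] : exists g : {unit F}, [set: {unit F}] = <[g]>%g.
  by apply/cyclicP/field_unit_group_cyclic.
have genF (y : F) : y != 0 -> exists i, y = val g ^+ i.
  move=> /neq0_unit[u ->].
  have /cycleP[i ->] : u \in <[g]>%g by rewrite -genE inE.
  by exists i; rewrite FinRing.val_unitX.
have g0 : val g != 0 by rewrite -unitfE; apply: valP.
have [i xE] := genF _ x0.
have ordg k : chi@[val g] ^+ k = 1 -> mulchar_trivial (mulchar_exp chi k%:Z).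
  move=> gk1; apply/mulchar_trivialP => y y0; have [j ->] := genF y y0.
  by rewrite mulchar_eval_exp ?expf_neq0 // mulchar_evalX // exprAC gk1 expr1n.
suff /dvdnP[j iE] : (m %| i)%N.
  by rewrite xE iE exprM mem_nonzero_power ?expf_neq0.
have rem1 : chi@[val g] ^+ (i %% m) = 1.
  rewrite -chix xE mulchar_evalX // {2}(divn_eq i m) exprD mulnC exprM.
  by rewrite mulchar_eval_order // expr1n mul1r.
case: chi_order => m0 _ ntr; rewrite /dvdn -leqn0 leqNgt; apply/negP => i0.
by have := ntr (i %% m)%N; rewrite i0 ltn_mod m0 ordg // => /(_ isT).
Qed.

(** At a nonzero [x] this is a geometric sum of ratio [chi x], an [m]th root of
unity; at [0] only the trivial character contributes. *)
Lemma sum_char_powers (x : F) :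
  \sum_(0 <= t < m) (mulchar_exp chi t%:Z)@[x]
    = m%:R * (x \in H)%:R + (x == 0)%:R.
Proof.
have [->|x0] := eqVneq x 0.
  rewrite !inE eqxx mulr0 add0r big_ltn ?mulchar_order_gt0 //.
  rewrite mulchar_eval0 mulchar_exp0_trivial big_nat big1 ?addr0 // => s sm.
  by rewrite mulchar_eval0 (negbTE (mulchar_exp_nontrivial sm)).
rewrite addr0 -mulchar_eval_eq1 //.
under eq_bigr do rewrite mulchar_eval_exp //.
have [->|chix] := eqVneq chi@[x] 1.
  under eq_bigr do rewrite expr1n.
  by rewrite mulr1 sumr_const_nat subn0.
rewrite mulr0 big_mkord; move: chix; rewrite -subr_eq0 => chix.
by apply: (mulfI chix); rewrite -subrX1 mulchar_eval_order // subrr mulr0.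
Qed.

Lemma sum_nonzero_powers (phi : F -> C) :
  \sum_(x | x != 0) (x \in H)%:R * phi x = \sum_(x in H) phi x.
Proof.
rewrite [RHS]big_mkcond [LHS]big_mkcond; apply: eq_bigr => x _.
by case: eqVneq => [->|_]; rewrite !inE ?eqxx //=; case: ifP;
  rewrite ?mul1r ?mul0r.
Qed.

(** Summing [sum_char_powers] over the nonzero elements counts [H]: of the
character sums only the trivial one survives. *)
Lemma card_nonzero_powers : (m * #|H|)%N = #|F|.-1.
Proof.
apply/eqP; rewrite -(Num.Theory.eqr_nat C); apply/eqP.
transitivity (\sum_(x : F | x != 0)
  \sum_(0 <= t < m) (mulchar_exp chi t%:Z)@[x]).
  under eq_bigr => x x0 do
    rewrite sum_char_powers (negbTE x0) addr0 mulrC.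
  by rewrite sum_nonzero_powers sumr_const -mulrnA.
rewrite exchange_big /= big_ltn ?mulchar_order_gt0 //.
rewrite [X in _ + X]big_nat [X in _ + X]big1 => [|s sm]; last first.
  exact/sum_neq0_mulchar_nontrivial/mulchar_exp_nontrivial.
under eq_bigr do rewrite mulchar_eval_exp // expr0.
by rewrite addr0 sumr_const -(cardC1 (0 : F)).
Qed.

(** * Fourier analysis modulo powers *)

(** The sums against [chi ^ s], taken over a translate [x |-> b * x], vanish
together with the original ones; adding them over [s] extracts the sum of [g]
over the coset [b * H], on which [g] is constant. *)
Lemma fourier_vanishing (g : F -> C) :
  (forall h a, h \in H -> g (h * a) = g a) ->
  (forall s, (s < m)%N ->
     \sum_(a | a != 0) (mulchar_exp chi s%:Z)@[a] * g a = 0) ->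
  forall b, b != 0 -> g b = 0.
Proof.
move=> gH coef0 b b0.
have coefb0 s : (s < m)%N ->
    \sum_(c | c != 0) (mulchar_exp chi s%:Z)@[c] * g (b * c) = 0.
  move=> sm; apply: (mulfI (mulchar_eval_neq0 (mulchar_exp chi s%:Z) b0)).
  rewrite mulr0 mulr_sumr; apply: etrans (coef0 s sm).
  rewrite [RHS](reindex_inj (mulfI b0)) /=.
  apply: eq_big => [c|c c0]; first by rewrite mulf_eq0 (negbTE b0).
  by rewrite mulrA -mulchar_evalM.
have sumH : m%:R * \sum_(c in H) g (b * c) = 0.
  rewrite -sum_nonzero_powers mulr_sumr.
  transitivity (\sum_(0 <= s < m)
      \sum_(c | c != 0) (mulchar_exp chi s%:Z)@[c] * g (b * c)).
    rewrite exchange_big /=; apply: eq_bigr => c c0.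
    by rewrite -mulr_suml sum_char_powers (negbTE c0) addr0 mulrA.
  by rewrite big_nat big1 // => s /andP[_]; apply: coefb0.
have : m%:R * #|H|%:R * g b = 0.
  rewrite -[RHS]sumH -mulrA; congr (_ * _).
  rewrite (eq_bigr (fun=> g b)) => [|c Hc]; last by rewrite mulrC gH.
  by rewrite sumr_const mulr_natl.
move/eqP; rewrite !mulf_eq0 !Num.Theory.pnatr_eq0.
by rewrite (gtn_eqF mulchar_order_gt0) (gtn_eqF (card_nonzero_powers_gt0 F m)) => /eqP.
Qed.

(** * Jacobi sums *)

(** The summand [1] is [psi (1 - 0)], multiplied by the correction at [0] in
[sum_char_powers].  The term [t = 0] may be left out of the sum: the trivial
character is [1] everywhere, at [0] included, so its Jacobi sum with [psi] is
the full sum of [psi], namely [0]. *)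
Lemma sum_jacobi (psi : mulchar F C) : ~~ mulchar_trivial psi ->
  m%:R * \sum_(z in H) psi@[1 - z] + 1
    = \sum_(1 <= t < m) jacobi_sum psi (mulchar_exp chi t%:Z).
Proof.
move=> ntr.
have jacE t : jacobi_sum psi (mulchar_exp chi t%:Z)
    = \sum_z psi@[1 - z] * (mulchar_exp chi t%:Z)@[z].
  rewrite /jacobi_sum (reindex_inj (can_inj (subKr 1))).
  by apply: eq_bigr => z _; rewrite subKr.
have jac0 : jacobi_sum psi (mulchar_exp chi 0%N%:Z) = 0.
  rewrite -[RHS](sum_mulchar_nontrivial ntr); apply: eq_bigr => z _.
  have [->|z0] := eqVneq (1 - z) 0.
    by rewrite mulchar_eval0 mulchar_exp0_trivial mulr1.
  by rewrite mulchar_eval_exp // mulr1.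
transitivity (\sum_(0 <= t < m) jacobi_sum psi (mulchar_exp chi t%:Z)).
  under [RHS]eq_bigr do rewrite jacE.
  rewrite exchange_big /=.
  under [RHS]eq_bigr do rewrite -mulr_sumr sum_char_powers mulrDr.
  rewrite big_split /=; congr (_ + _).
    rewrite mulr_sumr big_mkcond; apply: eq_bigr => z _.
    by case: (z \in H); rewrite ?mulr1 ?mulr0 // mulrC.
  rewrite (bigD1 0) //= big1 => [|z /negbTE ->]; last by rewrite mulr0.
  by rewrite eqxx subr0 mulchar_eval1 mulr1 addr0.
by rewrite big_ltn ?mulchar_order_gt0 // jac0 add0r.
Qed.

End CharacterOfOrder.

(** * Differences of powers *)

Section Differences.
Variables (F : finFieldType) (C : numFieldType).

Definition diff_count (D : {set F}) (a : F) : nat :=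
  #|[set xy in setX D D | xy.1 - xy.2 == a]|.

Lemma sum_diff_count (D : {set F}) (phi : F -> C) :
  \sum_a phi a * (diff_count D a)%:R
    = \sum_(x in D) \sum_(y in D) phi (x - y).
Proof.
rewrite pair_big /= (partition_big (fun xy => xy.1 - xy.2) xpredT) //=.
apply: eq_bigr => a _; rewrite (eq_bigr (fun=> phi a)) => [|xy /andP[_ /eqP ->]] //.
rewrite sumr_const mulr_natr /diff_count; congr (_ *+ _).
by apply: eq_card => xy; rewrite !inE.
Qed.

Lemma sum_neq0_diff_count (D : {set F}) :
  \sum_(a | a != 0) (diff_count D a)%:R = (#|D| * #|D|.-1)%:R :> C.
Proof.
have sumE := sum_diff_count D (fun a => (a != 0)%:R).
transitivity (\sum_(x in D) \sum_(y in D) (x - y != 0)%:R : C).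
  rewrite -sumE big_mkcond; apply: eq_bigr => a _.
  by case: eqP; rewrite ?mul0r ?mul1r.
rewrite (eq_bigr (fun=> #|D|.-1%:R)) => [|x Dx].
  by rewrite sumr_const -mulrnA mulnC.
rewrite (bigD1 x) //= subrr eqxx add0r.
rewrite (eq_bigr (fun=> 1)) => [|y /andP[_ yx]]; last first.
  by rewrite subr_eq0 eq_sym yx.
rewrite sumr_const (cardsD1 x D) Dx /=; congr _%:R.
by apply: eq_card => y; rewrite !inE andbC.
Qed.

(** Multiplication by [h] is a bijection between the pairs in [D] with
difference [a] and those with difference [h * a]. *)
Lemma diff_count_mul (D : {set F}) (h a : F) : h != 0 ->
  (forall x, (h * x \in D) = (x \in D)) ->
  diff_count D (h * a) = diff_count D a.
Proof.
move=> h0 hD; pose mulh (xy : F * F) := (h * xy.1, h * xy.2).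
have mulh_inj : injective mulh.
  by move=> [x y] [x' y'] [/(mulfI h0) -> /(mulfI h0) ->].
rewrite /diff_count -(card_preimset _ mulh_inj); apply: eq_card => -[x y].
by rewrite !inE /= !hD -mulrBr (inj_eq (mulfI h0)).
Qed.

(** When [x] and [y] are nonzero powers, [psi (x - y) = psi (1 - y / x)], and
[y / x] runs over the nonzero powers together with [y]; the terms [y = 0] and
[x = 0] give the two summands [1] and [psi (-1)]. *)
Lemma char_sum_differences (m : nat) (psi : mulchar F C) :
  ~~ mulchar_trivial psi ->
  (forall h, h \in nonzero_powers F m -> mulchar_eval psi h = 1) ->
  \sum_(x in powers_with_zero F m) \sum_(y in powers_with_zero F m)
      mulchar_eval psi (x - y)
    = #|nonzero_powers F m|%:R
      * (1 + mulchar_eval psi (-1)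
         + \sum_(z in nonzero_powers F m) mulchar_eval psi (1 - z)).
Proof.
move=> ntr psiH; rewrite sum_powers_with_zero sum_powers_with_zero.
have -> : mulchar_eval psi (0 - 0) = 0.
  by rewrite subrr mulchar_eval0 (negbTE ntr).
rewrite add0r (eq_bigr (fun=> mulchar_eval psi (-1))) => [|y Hy]; last first.
  have y0 := nonzero_power_neq0 Hy.
  by rewrite sub0r -[- y]mulN1r mulchar_evalM ?oppr_eq0 ?oner_neq0 //
    (psiH _ Hy) mulr1.
rewrite sumr_const -[_ *+ #|_|]mulr_natl.
set S := \sum_(z in _) mulchar_eval psi (1 - z).
rewrite (eq_bigr (fun=> 1 + S)) => [|x Hx].
  by rewrite sumr_const -[(1 + S) *+ _]mulr_natl -mulrDr addrCA addrA.
have x0 := nonzero_power_neq0 Hx.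
rewrite sum_powers_with_zero subr0 psiH //; congr (_ + _).
rewrite (reindex_inj (mulfI x0)); apply: eq_big => z.
  by rewrite mul_nonzero_power.
by move=> _; rewrite -{1}[x]mulr1 -mulrBr mulchar_evalMl // psiH // mul1r.
Qed.

End Differences.

(** With [psi = chi ^ s] and [c = 1 + psi (-1) + \sum_(z in H) psi (1 - z)], the
two sides of the Jacobi sum identity differ by [m * c], and the Fourier
coefficient is [#|H| * c]. *)
Lemma jacobi_identity_coefficient (F : finFieldType) (C : numFieldType)
    (m : nat) (chi : mulchar F C) (s : nat) :
  mulchar_has_order chi m -> (1 <= s < m)%N ->
  \sum_(1 <= t < m)
     jacobi_sum (mulchar_exp chi s%:Z) (mulchar_exp chi t%:Z)
    = 1 - m%:R - m%:R * mulchar_eval (mulchar_exp chi s%:Z) (-1)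
  <-> \sum_a mulchar_eval (mulchar_exp chi s%:Z) a
        * (diff_count (powers_with_zero F m) a)%:R = 0.
Proof.
move=> chi_order sm; have ntr := mulchar_exp_nontrivial chi_order sm.
have psiH := mulchar_exp_nonzero_power chi_order s.
rewrite sum_diff_count char_sum_differences //.
rewrite -(sum_jacobi chi_order ntr).
set S := \sum_(z in _) _; set e := mulchar_eval _ (-1).
have m0 : m%:R != 0 :> C.
  by rewrite Num.Theory.pnatr_eq0 -lt0n (mulchar_order_gt0 chi_order).
have f0 : #|nonzero_powers F m|%:R != 0 :> C.
  by rewrite Num.Theory.pnatr_eq0 -lt0n card_nonzero_powers_gt0.
have defect : m%:R * S + 1 - (1 - m%:R - m%:R * e) = m%:R * (1 + e + S).
  by ring.
split=> [/eqP|/eqP].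
  rewrite -subr_eq0 defect mulf_eq0 (negbTE m0) => /eqP ->.
  by rewrite mulr0.
rewrite mulf_eq0 (negbTE f0) => /eqP sum0.
by apply/eqP; rewrite -subr_eq0 defect sum0 mulr0.
Qed.

Theorem theorem3p5 (R : realType) (F : finFieldType) (q m f lambda : nat)
    (chi : mulchar F R[i]) :
  #|F| = q -> q = (m * f + 1)%N ->
  (0 < m)%N -> (0 < f)%N ->
  (f + 1)%N = (lambda * m)%N ->
  mulchar_has_order chi m ->
  is_difference_set q (f + 1) lambda (powers_with_zero F m) <->
  (forall s : nat, (1 <= s <= m - 1)%N ->
     \sum_(1 <= t < m)
        jacobi_sum (mulchar_exp chi s%:Z) (mulchar_exp chi t%:Z)
     = 1 - m%:R - m%:R * mulchar_eval (mulchar_exp chi s%:Z) (-1)).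
Proof.
move=> cardF qE m0 f0 fE chi_order; set M := powers_with_zero F m.
have cardH : #|nonzero_powers F m| = f.
  apply/eqP; rewrite -(eqn_pmul2l m0) (card_nonzero_powers chi_order).
  by rewrite cardF qE addn1.
have cardM : #|M| = (f + 1)%N by rewrite card_powers_with_zero cardH addn1.
have ntr s := mulchar_exp_nontrivial chi_order (s := s).
have psi0 s : (1 <= s < m)%N -> mulchar_eval (mulchar_exp chi s%:Z) 0 = 0.
  by move=> sm; rewrite mulchar_eval0 (negbTE (ntr s sm)).
have rangeE s : (1 <= s <= m - 1)%N = (1 <= s < m)%N.
  by rewrite subn1 -[in RHS](prednK m0) ltnS.
split=> [[_ _ countM] s | jacobi].
  rewrite rangeE => sm.
  apply/(jacobi_identity_coefficient chi_order sm).
  transitivity ((\sum_a mulchar_eval (mulchar_exp chi s%:Z) a) * lambda%:R).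
    rewrite mulr_suml; apply: eq_bigr => a _; have [->|a0] := eqVneq a 0.
      by rewrite psi0 ?mul0r.
    by rewrite [diff_count M a]countM.
  by rewrite sum_mulchar_nontrivial ?ntr // mul0r.
split=> // a a0; pose g b : R[i] := (diff_count M b)%:R - lambda%:R.
apply/eqP; rewrite -(Num.Theory.eqr_nat R[i]) -subr_eq0; apply/eqP.
apply: (fourier_vanishing (g := g) chi_order _ _ a0).
  move=> h b Hh; rewrite /g diff_count_mul ?(nonzero_power_neq0 Hh) // => x.
  exact: mul_powers_with_zero.
move=> s sm; under eq_bigr do rewrite /g mulrBr.
rewrite sumrB -mulr_suml.
have [->|s0] := posnP s.
  (* Trivial character: the coefficient is the number [f (f + 1)] of pairs of
     distinct elements of [M] minus [lambda (q - 1) = lambda m f]. *)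
  under eq_bigr do rewrite mulchar_eval_exp // expr0 mul1r.
  under [X in _ - X * _]eq_bigr do rewrite mulchar_eval_exp // expr0.
  rewrite sum_neq0_diff_count cardM sumr_const.
  rewrite (cardC1 (0 : F)) cardF qE addn1 addn1 /= -natrM.
  by rewrite -[f.+1]addn1 fE -mulnA [(lambda * _)%N]mulnC subrr.
have sm' : (1 <= s < m)%N by rewrite s0.
rewrite sum_neq0_mulchar_nontrivial ?ntr // mul0r subr0.
move: (sm'); rewrite -rangeE => /jacobi.
move/(jacobi_identity_coefficient chi_order sm').
by rewrite (bigD1 0) //= psi0 // mul0r add0r.
Qed.
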